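(* Let $G$ be a connected graph on $n$ vertices whose edge weights are $s\times s$ positive definite matrices, with Laplacian $L$ and resistance matrix $R$. Let $X=(L+\frac1n J\otimes I_s)^{-1}$ with $s\times s$ blocks $X_{i,j}$, let $\bar X$ be the block diagonal matrix with diagonal blocks $X_{1,1},\dots,X_{n,n}$, let $\bar x=\bar X(\mathbf{1}\otimes I_s)$, and let $\tau$ be the $ns\times s$ matrix whose $i$-th $s\times s$ block is $\tau_i=2I_s-\sum_{j\sim i}W_{i,j}^{-1}R_{j,i}$. Then $\tau'R\tau$ is positive definite and $$\tau'R\tau=2\bar x'L\bar x+\frac{8}{n}\Big[\sum_{i=1}^n X_{i,i}-I_s\Big].$$
   Context: $G$ is a simple connected graph with vertex set $\{1,\dots,n\}$; each edge $\{i,j\}$ carries a weight $W_{i,j}=W_{j,i}$, a real $s\times s$ positive definite matrix; $j\sim i$ means adjacency. The Laplacian $L$ is the $ns\times ns$ block matrix with $(i,i)$ block $\sum_{j\sim i}W_{i,j}^{-1}$, $(i,j)$ block ($i\ne j$) equal to $-W_{i,j}^{-1}$ if $i\sim j$ and $0$ otherwise. $J$ is the $n\times n$ all-ones matrix, $\mathbf{1}$ the all-ones column vector of length $n$, $\otimes$ the Kronecker product, $'$ transpose. Writing $K_{i,j}$ for the $s\times s$ blocks of the Moore--Penrose inverse $L^\dagger$, the resistance matrix $R$ is the $ns\times ns$ block matrix with blocks $R_{i,j}=K_{i,i}+K_{j,j}-2K_{i,j}$.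
   Formalization: Positive definiteness of τ'Rτ is stated only for n > 1: for a single vertex L = R = 0 and τ = 2I, so τ'Rτ = 0 is not positive definite; the identity is stated for all n ≥ 1. *)

(* Defs.v *)
From HB Require Import structures.
From mathcomp Require Import all_boot all_order all_algebra.
From mathcomp Require Import boolp classical_sets reals.

Set Implicit Arguments.
Unset Strict Implicit.
Unset Printing Implicit Defensive.

Import Order.TTheory GRing.Theory Num.Theory.
Local Open Scope ring_scope.

(* Positive definiteness includes symmetry. *)
Definition posdefmx (R : realType) (m : nat) (A : 'M[R]_m) : Prop :=
  A^T = A /\ forall v : 'cV[R]_m, v != 0 -> 0 < (v^T *m A *m v) 0 0.

(* The four Penrose equations; the transpose is the adjoint over the reals. *)
Definition is_moore_penrose (R : realType) (m n : nat)
    (A : 'M[R]_(m, n)) (P : 'M[R]_(n, m)) : Prop :=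
  [/\ A *m P *m A = A, P *m A *m P = P,
      (A *m P)^T = A *m P & (P *m A)^T = P *m A].

Definition moore_penrose (R : realType) (m n : nat) (A : 'M[R]_(m, n)) :
    'M[R]_(n, m) :=
  xget 0 [set P | is_moore_penrose A P]%classic.

Lemma is_moore_penrose_uniq (R : realType) (m n : nat) (A : 'M[R]_(m, n))
    (P Q : 'M[R]_(n, m)) :
  is_moore_penrose A P -> is_moore_penrose A Q -> P = Q.
Proof.
move=> [P1 P2 P3 P4] [Q1 Q2 Q3 Q4].
have AE : A *m P = A *m Q.
  have e : A *m Q *m (A *m P) = A *m P by rewrite mulmxA Q1.
  by rewrite -e -{1}Q3 -{1}P3 -trmx_mul mulmxA P1.
have EA : P *m A = Q *m A.
  have e : P *m A *m (Q *m A) = P *m A by rewrite -mulmxA (mulmxA A) Q1.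
  by rewrite -e -{1}P4 -{1}Q4 -trmx_mul -mulmxA (mulmxA A) P1.
by rewrite -P2 -mulmxA AE mulmxA EA Q2.
Qed.

Lemma gram_unitmx (R : realType) (r m : nat) (B : 'M[R]_(r, m)) :
  row_free B -> B *m B^T \in unitmx.
Proof.
move=> Bfree; rewrite -row_free_unit -kermx_eq0; apply/rowV0P => v.
move/sub_kermxP; rewrite mulmxA => vBB0.
have : v *m B == 0.
  have := congr1 (fun M => (M *m v^T) 0 0) vBB0.
  rewrite mul0mx -mulmxA -trmx_mul !mxE => /eqP.
  rewrite psumr_eq0; last by move=> k _; rewrite !mxE -expr2 sqr_ge0.
  move=> /allP h; apply/eqP/rowP => k; have := h k (mem_index_enum k).
  by rewrite /= [_^T _ _]mxE mulf_eq0 orbb => /eqP ->; rewrite mxE.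
by move=> /eqP vB0; apply: (row_free_inj Bfree); rewrite vB0 mul0mx.
Qed.

Lemma moore_penroseP (R : realType) (m n : nat) (A : 'M[R]_(m, n)) :
  is_moore_penrose A (moore_penrose A).
Proof.
apply: (@xgetPex _ 0 [set P | is_moore_penrose A P]%classic).
have uB := gram_unitmx (row_base_free A).
have uC : (col_base A)^T *m col_base A \in unitmx.
  rewrite -{2}[col_base A]trmxK; apply: gram_unitmx.
  by rewrite /row_free mxrank_tr; apply: col_base_full.
have := mulmx_base A; move: (col_base A) (row_base A) uB uC.
move: (\rank A) => r C B uB uC CB.
have sB : (invmx (B *m B^T))^T = invmx (B *m B^T).
  by rewrite trmx_inv trmx_mul trmxK.
have sC : (invmx (C^T *m C))^T = invmx (C^T *m C).
  by rewrite trmx_inv trmx_mul trmxK.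
pose P := B^T *m invmx (B *m B^T) *m (invmx (C^T *m C) *m C^T).
have AP : A *m P = C *m (invmx (C^T *m C) *m C^T).
  by rewrite -CB /P -!mulmxA (mulmxA B) (mulKVmx uB).
have PA : P *m A = B^T *m invmx (B *m B^T) *m B.
  by rewrite -CB /P -!mulmxA (mulmxA C^T C) (mulKmx uC).
exists P; split.
- by rewrite AP -CB -!mulmxA (mulmxA C^T) (mulKmx uC).
- by rewrite PA /P -!mulmxA (mulmxA B) (mulKVmx uB).
- by rewrite AP !trmx_mul trmxK sC mulmxA.
- by rewrite PA !trmx_mul trmxK sB mulmxA.
Qed.

(* An (n s) x (n s) matrix made of s x s blocks is indexed, as in the library,
   by 'I_(\sum_(i < n) s); its (i, j) block is submxblock _ i j. *)

Definition kron (R : realType) (m n p q : nat)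
    (A : 'M[R]_(m, n)) (B : 'M[R]_(p, q)) :
    'M[R]_(\sum_(i < m) p, \sum_(j < n) q) :=
  \mxblock_(i < m, j < n) (A i j *: B).

(* Kronecker product with a column vector on the left, with q columns instead
   of \sum_(j < 1) q. *)
Definition kron_col (R : realType) (m p q : nat)
    (u : 'cV[R]_m) (B : 'M[R]_(p, q)) : 'M[R]_(\sum_(i < m) p, q) :=
  \mxcol_(i < m) (u i 0 *: B).

Definition connected_graph (T : finType) (e : rel T) : Prop :=
  [/\ symmetric e, irreflexive e & forall x y : T, connect e x y].

(* Only the values W i j with e i j, i.e. on the edges, are meaningful. *)
Definition matrix_weights (R : realType) (n s : nat) (e : rel 'I_n)
    (W : 'I_n -> 'I_n -> 'M[R]_s) : Prop :=
  forall i j : 'I_n, e i j -> W i j = W j i /\ posdefmx (W i j).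

Section Resistance.

Variables (R : realType) (n s : nat) (e : rel 'I_n).
Variable (W : 'I_n -> 'I_n -> 'M[R]_s).

Definition laplacian : 'M[R]_(\sum_(i < n) s) :=
  \mxblock_(i < n, j < n)
    (if i == j then \sum_(k < n | e i k) invmx (W i k)
     else if e i j then - invmx (W i j) else 0).

Definition resistance : 'M[R]_(\sum_(i < n) s) :=
  let K (i j : 'I_n) : 'M[R]_s := submxblock (moore_penrose laplacian) i j in
  \mxblock_(i < n, j < n) (K i i + K j j - 2 *: K i j).

Definition Xmx : 'M[R]_(\sum_(i < n) s) :=
  invmx (laplacian + n%:R^-1 *: kron (const_mx 1 : 'M[R]_n) (1%:M : 'M[R]_s)).

Definition Xblock (i j : 'I_n) : 'M[R]_s := submxblock Xmx i j.

Definition Xbar : 'M[R]_(\sum_(i < n) s) := \mxdiag_(i < n) Xblock i i.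

Definition xbar : 'M[R]_(\sum_(i < n) s, s) :=
  Xbar *m kron_col (const_mx 1 : 'cV[R]_n) (1%:M : 'M[R]_s).

Definition tau : 'M[R]_(\sum_(i < n) s, s) :=
  \mxcol_(i < n)
    (2%:M - \sum_(j < n | e i j) invmx (W i j) *m submxblock resistance j i).

End Resistance.

(* Main.v *)
Require Import Defs.
From HB Require Import structures.
From mathcomp Require Import all_boot all_order all_algebra.
From mathcomp Require Import boolp classical_sets reals.
From mathcomp Require Import ring.

Set Implicit Arguments.
Unset Strict Implicit.
Unset Printing Implicit Defensive.

Import Order.TTheory GRing.Theory Num.Theory.
Local Open Scope ring_scope.

(* Let U be the column of n identity blocks, so that J (x) I = U U'.  By
   connectedness L is positive semidefinite with kernel the range of U, hence
   L + U U' / n is invertible, its inverse X satisfies X U = U and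
   L X = I - U U' / n, and the Moore-Penrose inverse of L is X - U U' / n.
   It follows that R = x U' + U x' - 2 X and tau = L x + (2 / n) U, where x is
   xbar, and expanding tau' R tau gives the identity.  Its bracket is the sum
   of the diagonal blocks of the Moore-Penrose inverse K of L; such a block is
   positive definite for n > 1, because K = K L K is positive semidefinite and
   a vector supported on a single block cannot lie in the range of U. *)

(** * Positive definite matrices and block preliminaries *)

Lemma connect_const (T : finType) (S : Type) (e : rel T) (f : T -> S) :
  (forall x y, e x y -> f x = f y) -> forall x y, connect e x y -> f x = f y.
Proof.
move=> fe x y /connectP[p + ->]; elim: p x => //= z p IHp x /andP[exz pz].
by rewrite (fe _ _ exz) IHp.
Qed.

Lemma posdefmx_unit (R : realType) (m : nat) (A : 'M[R]_m) :
  posdefmx A -> A \in unitmx.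
Proof.
move=> [_ Apos]; rewrite -row_free_unit -kermx_eq0; apply/rowV0P => v.
move=> /sub_kermxP vA0; apply: trmx_inj; rewrite trmx0; apply/eqP.
by apply/negPn/negP => /Apos; rewrite trmxK vA0 mul0mx mxE ltxx.
Qed.

(** Evaluating the form of [A] at [invmx A *m v] returns the form of [invmx A] at [v]. *)
Lemma posdefmx_inv (R : realType) (m : nat) (A : 'M[R]_m) :
  posdefmx A -> posdefmx (invmx A).
Proof.
move=> posA; have uA := posdefmx_unit posA; case: posA => symA Apos.
split=> [|v v_neq0]; first by rewrite trmx_inv symA.
have : invmx A *m v != 0.
  by apply: contra_neq v_neq0 => Av0; rewrite -(mulKVmx uA v) Av0 mulmx0.
by move=> /Apos; rewrite trmx_mul trmx_inv symA -!mulmxA mulKVmx.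
Qed.

Lemma posdefmx_ge0 (R : realType) (m : nat) (A : 'M[R]_m) (v : 'cV_m) :
  posdefmx A -> 0 <= (v^T *m A *m v) 0 0.
Proof.
move=> [_ Apos]; have [->|/Apos/ltW//] := eqVneq v 0.
by rewrite mulmx0 mxE.
Qed.

Lemma submxblockZ (R : pzRingType) (p q : nat) (p_ : 'I_p -> nat)
    (q_ : 'I_q -> nat) (a : R) (A : 'M[R]_(\sum_i p_ i, \sum_j q_ j)) i j :
  submxblock (a *: A) i j = a *: submxblock A i j.
Proof. by apply/matrixP => k l; rewrite !mxE. Qed.

Lemma submxcolZ (R : pzRingType) (p m : nat) (p_ : 'I_p -> nat) (a : R)
    (A : 'M[R]_(\sum_i p_ i, m)) i :
  submxcol (a *: A) i = a *: submxcol A i.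
Proof. by apply/matrixP => k l; rewrite !mxE. Qed.

Section Laplacian.

Variables (R : realType) (n s : nat) (e : rel 'I_n).
Variable W : 'I_n -> 'I_n -> 'M[R]_s.
Hypotheses (n_gt0 : (0 < n)%N) (conn_e : connected_graph e).
Hypothesis posW : matrix_weights e W.

Local Notation L := (laplacian e W).
Local Notation X := (Xmx e W).
Local Notation U := (kron_col (const_mx 1 : 'cV[R]_n) (1%:M : 'M[R]_s)).

Let n_neq0 : n%:R != 0 :> R. Proof. by rewrite pnatr_eq0 -lt0n. Qed.

Let e_sym : symmetric e. Proof. by case: conn_e. Qed.

(** * The block column [U] of identities *)

Lemma ones_mul p (v : 'M[R]_(s, p)) : U *m v = \mxcol_(i < n) v.
Proof. by rewrite mxcol_mul; apply: eq_mxcol => i; rewrite mxE scale1r mul1mx. Qed.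

Lemma tr_ones_mul p (y : 'M[R]_(\sum_(i < n) s, p)) :
  U^T *m y = \sum_i submxcol y i.
Proof.
rewrite -{1}[y]submxcolK tr_mxcol mul_mxrow_mxcol; apply: eq_bigr => i _.
by rewrite mxE scale1r trmx1 mul1mx.
Qed.

Lemma submxcol_ones i : submxcol U i = 1%:M.
Proof. by rewrite mxcolK mxE scale1r. Qed.

Lemma gram_ones : U^T *m U = n%:R%:M.
Proof.
rewrite tr_ones_mul (eq_bigr (fun=> 1%:M)) => [|i _]; last exact: submxcol_ones.
by rewrite sumr_const card_ord -scaler_nat scale_scalar_mx mulr1.
Qed.

Lemma kron_ones : kron (const_mx 1 : 'M[R]_n) (1%:M : 'M[R]_s) = U *m U^T.
Proof.
rewrite tr_mxcol mul_mxcol_mxrow; apply: eq_mxblock => i j.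
by rewrite !mxE !scale1r trmx1 mulmx1.
Qed.

(** The diagonal block carries the sum of the inverse weights around [i], so it can be distributed
    over the neighbours, turning a block row into weighted differences. *)
Lemma submxcol_laplacian p (y : 'M[R]_(\sum_(i < n) s, p)) i :
  submxcol (L *m y) i =
  \sum_(j | e i j) invmx (W i j) *m (submxcol y i - submxcol y j).
Proof.
case: conn_e => _ e_irr _.
rewrite -{1}[y]submxcolK mul_mxblock_mxrow mxcolK (bigD1 i) //= eqxx mulmx_suml.
under [RHS]eq_bigr do rewrite mulmxBr.
rewrite sumrB -sumrN; congr (_ + _).
rewrite [RHS]big_mkcond [RHS](bigD1 i) //= e_irr add0r.
apply: eq_bigr => j ji; rewrite eq_sym (negbTE ji).
by case: ifP => _; rewrite ?mulNmx ?mul0mx.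
Qed.

(** * The quadratic form of the Laplacian *)

Lemma tr_laplacian : L^T = L.
Proof.
rewrite tr_mxblock; apply: eq_mxblock => i j; rewrite [j == i]eq_sym e_sym.
have symV k l : e k l -> (invmx (W k l))^T = invmx (W k l).
  by move=> /posW[_ /posdefmx_inv[]].
case: eqVneq => [->|_].
  by rewrite raddf_sum; apply: eq_bigr => k ejk; apply: symV.
case: ifP => [eij|_]; last by rewrite trmx0.
by rewrite raddfN /= symV ?(e_sym j) //; case: (posW eij) => ->.
Qed.

(** The sum runs over ordered pairs and so meets every edge twice, whence the factor 2. *)
Lemma laplacian_form p (y : 'M[R]_(\sum_(i < n) s, p)) :
  let d i j := submxcol y i - submxcol y j in
  (y^T *m L *m y) *+ 2 =
  \sum_i \sum_(j | e i j) (d i j)^T *m invmx (W i j) *m d i j.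
Proof.
move=> d.
have formE : y^T *m L *m y =
    \sum_i \sum_(j | e i j) (submxcol y i)^T *m invmx (W i j) *m d i j.
  rewrite -mulmxA -{1}[y]submxcolK -[L *m y]submxcolK tr_mxcol mul_mxrow_mxcol.
  apply: eq_bigr => i _; rewrite submxcol_laplacian mulmx_sumr.
  by apply: eq_bigr => j _; rewrite mulmxA.
rewrite mulr2n {1}formE formE.
(* In the second copy the roles of [i] and [j] are exchanged; as [d j i = - d i j] and weights are
   symmetric, the left factors of the two copies combine into [(d i j)^T]. *)
under [X in _ + X]eq_bigr do rewrite big_mkcond.
rewrite [X in _ + X]exchange_big /= -big_split; apply: eq_bigr => i _ /=.
rewrite -big_mkcond /= [X in _ + X](eq_bigl (e i)) => [|j]; last by rewrite e_sym.
rewrite -big_split; apply: eq_bigr => j /posW[Wij _] /=.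
rewrite -Wij -[d j i]opprB -/(d i j) mulmxN -mulNmx -mulNmx -!mulmxDl.
by rewrite -raddfB.
Qed.

Lemma laplacian_form_ge0 (y : 'cV[R]_(\sum_(i < n) s)) :
  0 <= (y^T *m L *m y) 0 0.
Proof.
rewrite -(pmulrn_lge0 _ (isT : (0 < 2)%N)) -mulmxnE laplacian_form summxE.
apply: sumr_ge0 => i _; rewrite summxE; apply: sumr_ge0 => j /posW[_ posWij].
exact/posdefmx_ge0/posdefmx_inv.
Qed.

(** A vanishing sum of nonnegative edge terms has all its terms zero; definiteness of the inverse
    weights then makes adjacent blocks agree, and connectedness propagates this to all pairs. *)
Lemma laplacian_form_eq0 (y : 'cV[R]_(\sum_(i < n) s)) :
  (y^T *m L *m y) 0 0 = 0 -> forall i j, submxcol y i = submxcol y j.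
Proof.
move=> form0.
have pos0 i j : e i j -> 0 <= ((submxcol y i - submxcol y j)^T
    *m invmx (W i j) *m (submxcol y i - submxcol y j)) 0 0.
  by move=> /posW[_ posWij]; exact/posdefmx_ge0/posdefmx_inv.
have sum0 : \sum_i \sum_(j | e i j) ((submxcol y i - submxcol y j)^T
    *m invmx (W i j) *m (submxcol y i - submxcol y j)) 0 0 == 0.
  have := congr1 (fun A : 'M_1 => A 0 0) (laplacian_form y).
  rewrite /= mulmxnE form0 mul0rn summxE => sum0.
  by apply/eqP; rewrite [RHS]sum0; apply: eq_bigr => i _; rewrite summxE.
move=> i j; apply: (@connect_const _ _ e (submxcol y)); last by case: conn_e.
move=> {}i {}j eij; apply/eqP; rewrite -subr_eq0; apply/negPn/negP.
case: (posW eij) => _ /posdefmx_inv[_ posV] /posV; apply/negP.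
rewrite -leNgt.
move: sum0; rewrite psumr_eq0 => [/allP/(_ i (mem_index_enum i))/=|k _]; last first.
  by apply: sumr_ge0 => l; apply: pos0.
rewrite psumr_eq0 => [/allP/(_ j (mem_index_enum j))|k]; last exact: pos0.
by rewrite eij => /eqP->.
Qed.

Lemma laplacian_ones : L *m U = 0.
Proof.
apply/mxcolP => i; rewrite submxcol_laplacian submxcol0 big1 // => j _.
by rewrite !submxcol_ones subrr mulmx0.
Qed.

Lemma tr_ones_laplacian : U^T *m L = 0.
Proof. by rewrite -tr_laplacian -trmx_mul laplacian_ones trmx0. Qed.

(** * The inverse [X] and the Moore-Penrose inverse *)

Let M := L + n%:R^-1 *: (U *m U^T).

Let XE : X = invmx M. Proof. by rewrite /Xmx kron_ones. Qed.

Let trM : M^T = M.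
Proof. by rewrite raddfD /= tr_laplacian linearZ /= trmx_mul trmxK. Qed.

Let M_ones : M *m U = U.
Proof.
rewrite mulmxDl laplacian_ones add0r -scalemxAl -mulmxA gram_ones.
by rewrite mul_mx_scalar scalerA mulVf // scale1r.
Qed.

Let M_unit : M \in unitmx.
Proof.
rewrite -row_free_unit -kermx_eq0; apply/rowV0P => v /sub_kermxP vM0.
have My0 : M *m v^T = 0 by rewrite -trM -trmx_mul vM0 trmx0.
(* Since [M] is symmetric and fixes [U], the block sum of a kernel vector is zero. This removes the
   rank correction and leaves a vector killed by [L], whose equal blocks sum to zero. *)
have Uy0 : U^T *m v^T = 0.
  by rewrite -M_ones trmx_mul trM -mulmxA My0 mulmx0.
have Ly0 : L *m v^T = 0.
  by move: My0; rewrite mulmxDl -scalemxAl -mulmxA Uy0 mulmx0 scaler0 addr0.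
have yc := @laplacian_form_eq0 v^T; rewrite -mulmxA Ly0 mulmx0 mxE in yc.
apply: trmx_inj; rewrite trmx0; apply/mxcolP => i; rewrite submxcol0.
move: Uy0; rewrite tr_ones_mul (eq_bigr (fun=> submxcol v^T i)) => [|j _].
  rewrite sumr_const card_ord -scaler_nat => /eqP.
  by rewrite scaler_eq0 (negbTE n_neq0) => /eqP.
exact: yc.
Qed.

Lemma tr_Xmx : X^T = X.
Proof. by rewrite XE trmx_inv trM. Qed.

Lemma Xmx_ones : X *m U = U.
Proof. by rewrite XE -{1}M_ones mulKmx. Qed.

Lemma tr_ones_Xmx : U^T *m X = U^T.
Proof. by rewrite -tr_Xmx -trmx_mul Xmx_ones. Qed.

Lemma laplacian_Xmx : L *m X = 1%:M - n%:R^-1 *: (U *m U^T).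
Proof.
rewrite -(mulmxV M_unit) -XE mulmxDl -scalemxAl -mulmxA tr_ones_Xmx.
by rewrite addrK.
Qed.

Lemma Xmx_laplacian : X *m L = 1%:M - n%:R^-1 *: (U *m U^T).
Proof.
by rewrite -tr_laplacian -{1}tr_Xmx -trmx_mul laplacian_Xmx raddfB /=
  trmx1 linearZ /= trmx_mul trmxK.
Qed.

(** Multiplied by [L] on either side, the candidate gives the orthogonal projection onto the
    complement of the range of [U]; the Penrose equations follow, and uniqueness concludes. *)
Lemma moore_penrose_laplacian :
  moore_penrose L = X - n%:R^-1 *: (U *m U^T).
Proof.
apply: is_moore_penrose_uniq (moore_penroseP L) _.
have LK : L *m (X - n%:R^-1 *: (U *m U^T)) = 1%:M - n%:R^-1 *: (U *m U^T).
  by rewrite mulmxBr laplacian_Xmx -scalemxAr mulmxA laplacian_ones mul0mx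
    scaler0 subr0.
have KL : (X - n%:R^-1 *: (U *m U^T)) *m L = 1%:M - n%:R^-1 *: (U *m U^T).
  by rewrite mulmxBl Xmx_laplacian -scalemxAl -mulmxA tr_ones_laplacian mulmx0
    scaler0 subr0.
have trP : (1%:M - n%:R^-1 *: (U *m U^T))^T = 1%:M - n%:R^-1 *: (U *m U^T).
  by rewrite raddfB /= trmx1 linearZ /= trmx_mul trmxK.
split; rewrite ?LK ?KL //.
  by rewrite mulmxBl mul1mx -scalemxAl -mulmxA tr_ones_laplacian mulmx0
    scaler0 subr0.
rewrite mulmxBl mul1mx -scalemxAl -mulmxA mulmxBr tr_ones_Xmx -scalemxAr.
rewrite mulmxA gram_ones mul_scalar_mx scalerA mulVf // scale1r.
by rewrite subrr mulmx0 scaler0 subr0.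
Qed.

Lemma laplacian_moore_penrose :
  L *m moore_penrose L = 1%:M - n%:R^-1 *: (U *m U^T).
Proof.
by rewrite moore_penrose_laplacian mulmxBr laplacian_Xmx -scalemxAr mulmxA
  laplacian_ones mul0mx scaler0 subr0.
Qed.

Lemma submxblock_moore_penrose i j :
  submxblock (moore_penrose L) i j = Xblock e W i j - n%:R^-1%:M.
Proof.
rewrite moore_penrose_laplacian -kron_ones submxblockB; congr (_ - _).
by rewrite submxblockZ mxblockK mxE scale1r scale_scalar_mx mulr1.
Qed.

(** * The resistance matrix and [tau] in terms of [X] *)

Lemma tr_Xblock i j : (Xblock e W i j)^T = Xblock e W j i.
Proof. by rewrite tr_submxblock tr_Xmx. Qed.

Lemma xbarE : xbar e W = \mxcol_(i < n) Xblock e W i i.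
Proof.
rewrite /xbar /Xbar mul_mxdiag_mxcol; apply: eq_mxcol => i.
by rewrite mxE scale1r mulmx1.
Qed.

Lemma tr_ones_xbar : U^T *m xbar e W = \sum_i Xblock e W i i.
Proof. by rewrite tr_ones_mul xbarE; apply: eq_bigr => i _; rewrite mxcolK. Qed.

(** The shifts by 1/n cancel, since the coefficients 1, 1 and -2 sum to zero. *)
Lemma resistance_block i j :
  submxblock (resistance e W) i j =
  Xblock e W i i + Xblock e W j j - 2 *: Xblock e W i j.
Proof.
rewrite mxblockK !submxblock_moore_penrose scalerBr !scaler_nat !mulr2n.
by apply/matrixP => k l; rewrite !mxE; ring.
Qed.

Lemma resistanceE :
  resistance e W = xbar e W *m U^T + U *m (xbar e W)^T - 2 *: X.
Proof.
rewrite xbarE !tr_mxcol !mul_mxcol_mxrow -[X]submxblockK.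
apply/mxblockP => i j; rewrite resistance_block submxblockB submxblockD.
by rewrite submxblockZ !mxblockK !mxE !scale1r trmx1 mulmx1 mul1mx tr_Xblock.
Qed.

Lemma tauE : tau e W = L *m xbar e W + (2 / n%:R) *: U.
Proof.
apply/mxcolP => i; rewrite mxcolK submxcolD submxcol_laplacian.
rewrite submxcolZ submxcol_ones scale_scalar_mx mulr1.
have LXii : \sum_(j | e i j) invmx (W i j) *m (Xblock e W i i - Xblock e W j i)
    = (1 - n%:R^-1)%:M.
  transitivity (submxblock (L *m X) i i).
    rewrite submxblockEh -mul_submxrow submxcol_laplacian.
    by under [RHS]eq_bigr do rewrite -!submxblockEh.
  rewrite laplacian_Xmx -kron_ones submxblockB.
  rewrite submxblockZ mxblockK mxE scale1r scale_scalar_mx mulr1 raddfB; congr (_ - _).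
  by rewrite -mxdiagZ submxblock_diag.
(* The resistance block splits as 2 (X_ii - X_ji) - (X_ii - X_jj): the first part is a diagonal
   block of [L *m X], the second a block of [L *m xbar]. *)
have -> : \sum_(j | e i j) invmx (W i j) *m submxblock (resistance e W) j i =
    2 *: (1 - n%:R^-1)%:M -
    \sum_(j | e i j) invmx (W i j) *m (Xblock e W i i - Xblock e W j j).
  rewrite -LXii scaler_sumr -sumrB; apply: eq_bigr => j _.
  rewrite scalemxAr -mulmxBr resistance_block; congr (_ *m _).
  by apply/matrixP => k l; rewrite !mxE; ring.
(* The remaining constant is 2 - 2 (1 - 1/n) = 2/n. *)
rewrite xbarE; under [X in _ = X + _]eq_bigr do rewrite !mxcolK.
by rewrite opprB addrCA scale_scalar_mx -raddfB /=; congr (_ + _%:M); ring.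
Qed.

Lemma tr_tau_resistance_tau :
  (tau e W)^T *m resistance e W *m tau e W =
    2 *: ((xbar e W)^T *m L *m xbar e W)
    + (8 / n%:R) *: (\sum_(i < n) Xblock e W i i - 1%:M).
Proof.
have := tr_ones_xbar; have := tauE; have := resistanceE.
move: (xbar e W) (tau e W) => x t RE tE; set S := \sum_i Xblock e W i i => Ux.
set Q := x^T *m L *m x; set c : R := 2 / n%:R in tE *.
have trS : S^T = S by rewrite raddf_sum; apply: eq_bigr => i _; apply: tr_Xblock.
have xU : x^T *m U = S by rewrite -trS -Ux trmx_mul trmxK.
have Ut : U^T *m t = 2%:M.
  rewrite tE mulmxDr mulmxA tr_ones_laplacian mul0mx add0r -scalemxAr.
  by rewrite gram_ones scale_scalar_mx mulfVK.
have tU : t^T *m U = 2%:M by rewrite -(trmxK U) -trmx_mul Ut tr_scalar_mx.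
have xt : x^T *m t = Q + c *: S by rewrite tE mulmxDr mulmxA -scalemxAr xU.
have tx : t^T *m x = Q + c *: S.
  rewrite -[t^T *m x]trmxK trmx_mul trmxK xt raddfD /= linearZ /= trS.
  by rewrite !trmx_mul trmxK tr_laplacian mulmxA.
have Xt : X *m t = x - n%:R^-1 *: (U *m S) + c *: U.
  rewrite tE mulmxDr mulmxA Xmx_laplacian mulmxBl mul1mx -scalemxAl -mulmxA Ux.
  by rewrite -scalemxAr Xmx_ones.
have tXt : t^T *m (X *m t) = Q + c *: S - c *: S + (2 * c)%:M.
  rewrite Xt mulmxDr mulmxBr -!scalemxAr (mulmxA _ U) tU tx mul_scalar_mx.
  by rewrite scale_scalar_mx scalerA [_^-1 * _]mulrC [c * 2]mulrC.
(* The two terms of [R] containing [U] contribute 4 (Q + c S), and the term -2 X contributes -2 Q -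
   4 c I, where 4 c = 8/n. *)
rewrite RE mulmxBr mulmxBl mulmxDr mulmxDl -!mulmxA Ut (mulmxA _ U) tU xt.
rewrite -scalemxAl -scalemxAr tXt (mulmxA _ x) tx mul_mx_scalar mul_scalar_mx.
by apply/matrixP => i j; rewrite !mxE /c; field.
Qed.

Lemma moore_penrose_laplacian_posdef (i : 'I_n) :
  (1 < n)%N -> posdefmx (submxblock (moore_penrose L) i i).
Proof.
move=> n_gt1; set K := moore_penrose L.
have KLK : K *m L *m K = K by case: (moore_penroseP L).
have trK : K^T = K.
  by rewrite /K moore_penrose_laplacian raddfB /= tr_Xmx linearZ /= trmx_mul trmxK.
split=> [|v v_neq0]; first by rewrite tr_submxblock trK.
(* Padding [v] with zero blocks turns the form of the diagonal block into the form of [K]. *)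
pose z : 'cV[R]_(\sum_(j < n) s) := \mxcol_(j < n) if j == i then v else 0.
have -> : v^T *m submxblock K i i *m v = z^T *m K *m z.
  rewrite -[in RHS](submxblockK K) -[RHS]mulmxA /z mul_mxblock_mxrow tr_mxcol.
  rewrite mul_mxrow_mxcol (bigD1 i) //= eqxx [X in _ + X]big1 => [|j /negbTE->].
    rewrite addr0 (bigD1 i) //= eqxx big1 => [|j /negbTE->].
      by rewrite addr0 mulmxA.
    by rewrite mulmx0.
  by rewrite trmx0 mul0mx.
have formE : z^T *m K *m z = (K *m z)^T *m L *m (K *m z).
  by rewrite trmx_mul trK -[in LHS]KLK !mulmxA.
rewrite formE lt_neqAle laplacian_form_ge0 andbT eq_sym.
apply: contra_neq v_neq0 => /laplacian_form_eq0 Kz_const.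
have LKz : L *m (K *m z) = 0.
  apply/mxcolP => j; rewrite submxcol_laplacian submxcol0 big1 // => k _.
  by rewrite (Kz_const j k) subrr mulmx0.
(* The second vertex is 1 if [i] is 0, and 0 otherwise. *)
have [j ji] : exists j : 'I_n, j != i.
  have [i0|i_neq0] := eqVneq (i : nat) 0%N.
    by exists (Ordinal n_gt1); rewrite -val_eqE /= i0.
  by exists (Ordinal n_gt0); rewrite -val_eqE /= eq_sym.
(* As [L *m K] is the projection along [U], its vanishing at [z] makes all blocks of [z] equal;
   block [j] is zero and block [i] is [v]. *)
move: LKz; rewrite mulmxA laplacian_moore_penrose mulmxBl mul1mx -scalemxAl.
rewrite -mulmxA ones_mul => /eqP; rewrite subr_eq0 => /eqP zE.
have z_const k : submxcol z k = n%:R^-1 *: (U^T *m z).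
  by rewrite {1}zE submxcolZ mxcolK.
by have := z_const i; rewrite -(z_const j) !mxcolK eqxx (negbTE ji).
Qed.

End Laplacian.

Lemma posdefmx_sum (R : realType) (m n : nat) (A : 'I_n -> 'M[R]_m) :
  (0 < n)%N -> (forall i, posdefmx (A i)) -> posdefmx (\sum_i A i).
Proof.
move=> n_gt0 posA; split=> [|v v_neq0].
  by rewrite raddf_sum; apply: eq_bigr => i _; case: (posA i).
rewrite mulmx_sumr mulmx_suml summxE (bigD1 (Ordinal n_gt0)) //=.
apply: ltr_pwDl; first by case: (posA (Ordinal n_gt0)) => _; apply.
by apply: sumr_ge0 => i _; apply: posdefmx_ge0.
Qed.

(** Definiteness is claimed for [1 < n]: on a single vertex the Laplacian vanishes, [Xmx] is the
    identity, and both sides of the formula are zero. *)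
Theorem theorem3p6 (R : realType) (n s : nat) (e : rel 'I_n)
    (W : 'I_n -> 'I_n -> 'M[R]_s)
    (n_gt0 : (0 < n)%N)
    (conn_e : connected_graph e)
    (posW : matrix_weights e W) :
  ((1 < n)%N -> posdefmx ((tau e W)^T *m resistance e W *m tau e W)) /\
  (tau e W)^T *m resistance e W *m tau e W =
    2 *: ((xbar e W)^T *m laplacian e W *m xbar e W)
    + (8 / n%:R) *: (\sum_(i < n) Xblock e W i i - 1%:M).
Proof.
have tRt := tr_tau_resistance_tau n_gt0 conn_e posW.
split=> // n_gt1; rewrite tRt.
(* The identity is spread as I/n over the [n] diagonal blocks. *)
have -> : \sum_(i < n) Xblock e W i i - 1%:M =
    \sum_(i < n) submxblock (moore_penrose (laplacian e W)) i i.
  under [RHS]eq_bigr do rewrite submxblock_moore_penrose //.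
  rewrite sumrB sumr_const card_ord -scaler_nat scale_scalar_mx divff //.
  by rewrite pnatr_eq0 -lt0n.
have [symS posS] := posdefmx_sum n_gt0
  (fun i => moore_penrose_laplacian_posdef n_gt0 conn_e posW i n_gt1).
split=> [|v v_neq0].
  by rewrite raddfD /= !linearZ /= symS trmx_mul (trmx_mul (xbar e W)^T)
    trmxK tr_laplacian // mulmxA.
rewrite mulmxDr mulmxDl -!scalemxAr -!scalemxAl mxE [X in X + _]mxE [X in _ + X]mxE.
(* The Laplacian term is only nonnegative; strictness comes from the blocks of the Moore-Penrose
   inverse. *)
apply: ltr_wpDl.
  have -> x : v^T *m (x^T *m laplacian e W *m x) *m v =
      (x *m v)^T *m laplacian e W *m (x *m v) by rewrite trmx_mul !mulmxA.
  by rewrite mulr_ge0 // laplacian_form_ge0.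
by rewrite mulr_gt0 ?divr_gt0 ?ltr0n //; apply: posS.
Qed.
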